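(* For all integers $k,n\geqslant 0$, there is a bijection between the maximal chains in the poset $\Sigma^k_n C^n_1$ and the words $w$ of length $(k+1)n$ over an alphabet $\{a_1,\dots,a_n\}$ of $n$ distinct letters such that each letter occurs exactly $k+1$ times in $w$, and for each prefix $z$ of $w$ and each $i$, either $a_i$ does not occur in $z$, or for each $j>i$ the letter $a_i$ occurs in $z$ at least as many times as $a_j$.
   Context: For $r\geqslant 0$, $C_r$ is the chain $\{0<1<\dots<r\}$ and $C_r^n$ its $n$-th cartesian power with componentwise order. Stacking (lax sum): given a sequence of posets $M_0,M_1,\dots$ with monotone maps $f_j\colon M_j\to M_{j+1}$, the poset $\Sigma_nM_n$ has elements the pairs $(x,j)$ with $0\leqslant j\leqslant n$, $x\in M_j$, ordered by $(x,j)\leqslant(y,k)$ iff $j\leqslant k$ and $(f_{k-1}\circ\dots\circ f_j)(x)\leqslant y$ in $M_k$ (identity composite when $j=k$). The maps $(x,j)\mapsto(x,j)$ from $\Sigma_nM_n$ to $\Sigma_{n+1}M_{n+1}$ make $(\Sigma_nM_n)_n$ a sequence of the same kind. Iterated stacking: $\Sigma^0_nM_n=M_n$ and $\Sigma^{k}_nM_n$ is the stacking of $(\Sigma^{k-1}_nM_n)_n$. $\Sigma^k_nC^n_1$ is the $k$-iterated stacking of $C^0_1\to C^1_1\to\dots$ with maps $(x_1,\dots,x_i)\mapsto(0,x_1,\dots,x_i)$. *)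

(* Defs.v *)
From HB Require Import structures.
From mathcomp Require Import all_boot all_order.

Set Implicit Arguments.
Unset Strict Implicit.
Unset Printing Implicit Defensive.

Import Order.TTheory.

Record posetSeq (d : Order.disp_t) := PosetSeq {
  pseq_obj :> nat -> finPOrderType d;
  pseq_map : forall n, pseq_obj n -> pseq_obj n.+1;
  pseq_mono : forall n, {homo @pseq_map n : x y / (x <= y)%O} }.

Arguments pseq_map {d} M {n} x : rename.

Section Stacking.

Variables (d : Order.disp_t) (M : posetSeq d).

Fixpoint pseq_shift j m : M j -> M (m + j) :=
  if m is m'.+1 then fun x => pseq_map M (pseq_shift m' x) else id.

(* The composite f_(k-1) o ... o f_j. *)
Definition pseq_comp j k (le_jk : j <= k) (x : M j) : M k :=
  ecast i (M i) (subnK le_jk) (pseq_shift (k - j) x).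

Lemma pseq_compE j k m (le_jk : j <= k) (e : m + j = k) (x : M j) :
  pseq_comp le_jk x = ecast i (M i) e (pseq_shift m x).
Proof.
have em : k - j = m by rewrite -e addnK.
rewrite /pseq_comp; move: (subnK le_jk); rewrite em => e'.
by rewrite (eq_irrelevance e e').
Qed.

Lemma pseq_comp_id j (le_jj : j <= j) (x : M j) : pseq_comp le_jj x = x.
Proof. exact: (@pseq_compE j j 0 le_jj (erefl j)). Qed.

Lemma pseq_compS j k (le_jk : j <= k) (le_jk1 : j <= k.+1) (x : M j) :
  pseq_comp le_jk1 x = pseq_map M (pseq_comp le_jk x).
Proof.
move: (le_jk) (le_jk1) (subnK le_jk) => h1 h2.
move: (k - j) => m e; case: k / e le_jk le_jk1 h1 h2 => _ _ h1 h2.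
rewrite (@pseq_compE j (m + j) m h1 (erefl _)).
by rewrite (@pseq_compE j (m + j).+1 m.+1 h2 (erefl _)).
Qed.

Lemma pseq_comp_trans i j k (le_ij : i <= j) (le_jk : j <= k) (le_ik : i <= k)
    (x : M i) : pseq_comp le_ik x = pseq_comp le_jk (pseq_comp le_ij x).
Proof.
elim: k => [|k IHk] in le_jk le_ik *.
  have j0 : j = 0 by apply/eqP; rewrite -leqn0.
  move: le_ij le_jk; rewrite j0 => le_ij le_jk.
  by rewrite pseq_comp_id (bool_irrelevance le_ij le_ik).
have [le_jk' | lt_kj] := leqP j k.
  have le_ik' := leq_trans le_ij le_jk'.
  by rewrite !(@pseq_compS _ k) (IHk le_jk').
have ej : j = k.+1 by apply/eqP; rewrite eqn_leq le_jk.
move: {IHk lt_kj} le_ij le_jk; rewrite ej => le_ij le_jk.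
by rewrite pseq_comp_id (bool_irrelevance le_ij le_ik).
Qed.

Lemma pseq_comp_mono j k (le_jk : j <= k) :
  {homo pseq_comp le_jk : x y / (x <= y)%O}.
Proof.
move=> x y le_xy; rewrite /pseq_comp; move: (subnK le_jk).
move: (k - j) => m; case: k / {le_jk}.
by elim: m => //= m IHm; apply: pseq_mono.
Qed.

Definition stack_type n : Type := {j : 'I_n.+1 & M j}.

HB.instance Definition _ n := Finite.copy (stack_type n) {j : 'I_n.+1 & M j}.

(* The branch on idP makes the proof of j <= k available to the composite; see *)
(* stack_leP.                                                                  *)
Definition stack_le n (u v : stack_type n) : bool :=
  if @idP (tag u <= tag v) is ReflectT le_uv
  then (pseq_comp le_uv (tagged u) <= tagged v)%O else false.

Lemma stack_leP n (u v : stack_type n) :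
  reflect (exists le_uv : tag u <= tag v,
             (pseq_comp le_uv (tagged u) <= tagged v)%O)
          (stack_le u v).
Proof.
rewrite /stack_le; case: {-}_ / idP => [h | nh]; last by right; case.
apply: (iffP idP) => [le_xy | [h']]; first by exists h.
by rewrite (bool_irrelevance h' h).
Qed.

Fact stack_le_refl n : reflexive (@stack_le n).
Proof.
by move=> u; apply/stack_leP; exists (leqnn _); rewrite pseq_comp_id.
Qed.

Fact stack_le_anti n : antisymmetric (@stack_le n).
Proof.
move=> [j x] [k y] /andP[/stack_leP[/= h le_xy] /stack_leP[/= h' le_yx]].
have ejk : j = k by apply/val_inj/eqP; rewrite eqn_leq h.
case: k / ejk y h h' le_xy le_yx => y h h'; rewrite !pseq_comp_id => xy yx.
by congr existT; apply/le_anti; rewrite xy.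
Qed.

Fact stack_le_trans n : transitive (@stack_le n).
Proof.
move=> [j y] [i x] [k z] /stack_leP[/= hij le_xy] /stack_leP[/= hjk le_yz].
apply/stack_leP; exists (leq_trans hij hjk) => /=.
by rewrite (pseq_comp_trans hij hjk) (le_trans _ le_yz) ?pseq_comp_mono.
Qed.

HB.instance Definition _ n := Order.Le_isPOrder.Build d (stack_type n)
  (@stack_le_refl n) (@stack_le_anti n) (@stack_le_trans n).

Definition stack_map n (u : stack_type n) : stack_type n.+1 :=
  let: existT j x := u in
  existT (fun j : 'I_n.+2 => M j) (widen_ord (leqnSn n.+1) j) x.

Fact stack_mono n : {homo @stack_map n : u v / (u <= v)%O}.
Proof. by move=> [j x] [k y] le_uv; exact: le_uv. Qed.

Definition stack : posetSeq d := PosetSeq stack_mono.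

End Stacking.

Definition stack_iter d k (M : posetSeq d) : posetSeq d := iter k (@stack d) M.

Section Cubes.

Variable r : nat.

Definition cube_map n (x : n.-tupleprod 'I_r.+1) : n.+1.-tupleprod 'I_r.+1 :=
  [tuple of ord0 :: x].

Fact cube_mono n : {homo @cube_map n : x y / (x <= y)%O}.
Proof.
move=> x y; rewrite !leEtprod => /forallP le_xy; apply/forallP=> i.
by case: (unliftP ord0 i) => [j|] ->; rewrite ?tnth0 ?tnthS.
Qed.

(* C_r^0 -> C_r^1 -> ..., where C_r is 'I_r.+1 *)
Definition cube_seq : posetSeq _ := PosetSeq cube_mono.

End Cubes.

Section MaximalChains.

Variables (d : Order.disp_t) (P : finPOrderType d).

Definition is_chain (A : {set P}) : bool :=
  [forall x in A, forall y in A, (x >=< y)%O].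

Definition max_chain : Type := {A : {set P} | maxset is_chain A}.

End MaximalChains.

(* The letter a_(i+1) is i : 'I_n. *)
Section Words.

Variables k n : nat.

Definition prefix_cond (z : seq 'I_n) : bool :=
  [forall i, (i \notin z) ||
     [forall (j : 'I_n | i < j), count_mem j z <= count_mem i z]].

Definition word_cond (w : seq 'I_n) : bool :=
  [forall i, count_mem i w == k.+1] &&
  [forall m : 'I_(size w).+1, prefix_cond (take m w)].

Definition good_word : Type := {w : (k.+1 * n).-tuple 'I_n | word_cond w}.

Lemma word_condP (w : seq 'I_n) :
  reflect
    ((forall i, count_mem i w = k.+1) /\
     (forall z, prefix z w -> forall i : 'I_n,
        i \notin z \/
        forall j : 'I_n, i < j -> count_mem j z <= count_mem i z))
    (word_cond w).
Proof.
apply: (iffP andP) => [[/forallP hc /forallP hp] | [hc hp]].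
  split=> [i | z pz i]; first exact/eqP.
  have lt_z : size z < (size w).+1 by rewrite ltnS size_prefix.
  have := forallP (hp (Ordinal lt_z)) i.
  have -> : take (Ordinal lt_z) w = z by apply/eqP; rewrite -prefixE.
  by case/orP=> [|/forall_inP]; [left | right].
split; first by apply/forallP=> i; apply/eqP.
apply/forallP=> m; apply/forallP=> i; apply/orP.
have pm : prefix (take m w) w by apply: prefix_take.
by have [|h] := hp _ pm i; [left | right; apply/forall_inP].
Qed.

End Words.

(* Main.v *)
Require Import Defs.
From mathcomp Require Import all_boot all_order.
From mathcomp Require Import zify.

Set Implicit Arguments.
Unset Strict Implicit.
Unset Printing Implicit Defensive.

Import Order.TTheory.

(** An element of the [k]-iterated stacking is a vector [x] together with
    indices [j_1 <= ... <= j_k <= n], where [x] has length [j_1].  Counting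
    coordinates from the right, so that padding with zeros on the left is
    invisible, record for each position [t] the number
    [b t = x_t + #{m | t < j_m}].  This identifies the poset with the set of
    functions [b <= k+1] such that [min(b, k)] is nonincreasing, ordered
    pointwise.  In that poset every covering relation decreases one value of
    [b] by one, so reading a maximal chain from the top down spells a word in
    which every position occurs [k+1] times, and the condition on prefixes says
    exactly that all the functions met along the way are admissible. *)

(** * Maximal chains, states and words *)

Lemma max_chainP d (P : finPOrderType d) (A : {set P}) :
  reflect ({in A &, forall x y, (x >=< y)%O} /\
           forall y, {in A, forall x, (y >=< x)%O} -> y \in A)
          (maxset (@is_chain d P) A).
Proof.
have chainP (B : {set P}) :
    reflect {in B &, forall x y, (x >=< y)%O} (is_chain B).
  apply: (iffP forall_inP) => [h x y xB yB | h x xB].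
    exact: (forall_inP (h x xB)).
  by apply/forall_inP => y yB; apply: h.
apply: (iffP maxsetP) => [[/chainP cA maxA]|[cA maxA]].
  split=> // y hy; rewrite -(maxA (y |: A)) ?setU11 ?subsetUr //.
  apply/chainP => a b /setU1P[->|aA] /setU1P[->|bA].
  - exact: comparablexx.
  - exact: hy.
  - by rewrite comparable_sym; apply: hy.
  - exact: cA.
split=> [|B /chainP cB sAB]; first exact/chainP.
apply/eqP; rewrite eqEsubset sAB andbT; apply/subsetP => y yB.
by apply: maxA => x xA; apply: cB => //; apply: (subsetP sAB).
Qed.

(* Indexed by letters: the letter [i] is position [n - 1 - i] from the right, so
   [min(b, k)] is nondecreasing here. *)
Definition is_state k n (b : 'I_n -> nat) : Prop :=
  (forall i, b i <= k.+1) /\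
  (forall i j : 'I_n, i < j -> minn (b i) k <= minn (b j) k).

Lemma eq_is_state k n (b b' : 'I_n -> nat) :
  b =1 b' -> is_state k b -> is_state k b'.
Proof.
by move=> e [b1 b2]; split=> [i|i j ij]; rewrite -!e; [apply: b1 | apply: b2].
Qed.

(** A value [k.+1] drops to [k] without changing its truncation at [k]. Failing that, take the least
    [i] with [b i < b' i]: below [i] the two functions agree, so [minn (b' j) k <= minn (b i) k],
    and [b i <= b' i - 1]. *)
Lemma is_state_unit_step k n (b b' : 'I_n -> nat) :
  is_state k b -> is_state k b' -> (forall i, b i <= b' i) ->
  (exists i, b i < b' i) ->
  exists2 i, b i < b' i & is_state k (fun j => b' j - (j == i)).
Proof.
move=> [_ mb] [b'k mb'] le_bb' ex_lt.
(* Lowering [b'] at [i] can break monotonicity only against indices below [i]. *)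
have step (i : 'I_n) :
    (forall j : 'I_n, j < i -> minn (b' j) k <= minn (b' i - 1) k) ->
    is_state k (fun j => b' j - (j == i)).
  move=> hi; split=> [j|j l jl]; first by rewrite (leq_trans (leq_subr _ _)).
  have := mb' j l jl; case: (l =P i) jl => [->|_] jl.
    by have := hi j jl; case: (j == i); lia.
  by case: (j == i); lia.
case: (pickP (fun i => (b i < b' i) && (b' i == k.+1))) => [i|no].
  case/andP=> lt_i /eqP e.
  exists i => //; apply: step => j ji; have := mb' j i ji; lia.
case: ex_lt => i0 lt0.
case: (@arg_minnP _ i0 (fun i => b i < b' i) val lt0) => /= i lt_i min_i.
exists i => //; apply: step => j ji.
have := mb j i ji; have := min_i j; have := le_bb' j; have := no i.
have := b'k i; rewrite lt_i /= => h1 /eqP h2; lia.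
Qed.

(** Suffix counts are [k.+1] minus prefix counts. Once [i] has occurred, at most [k] copies remain,
    so truncation does not affect it and the two inequalities coincide. Before that its truncated
    value is [k], and the state inequality says that [j] has occurred at most once. *)
Lemma word_cond_state k n (w : seq 'I_n) :
  word_cond k w <->
  (forall i, count_mem i w = k.+1) /\
  (forall m, is_state k (fun i => count_mem i (drop m w))).
Proof.
have cntE m i : count_mem i (take m w) + count_mem i (drop m w) = count_mem i w.
  by rewrite -count_cat cat_take_drop.
split=> [/word_condP[cw pw]|[cw sw]].
  split=> // m; split=> [i|i j ij]; first by have := cntE m i; rewrite cw; lia.
  have := cntE m i; have := cntE m j; rewrite !cw => ej ei.
  case: (pw _ (prefix_take w m) i) => [/count_memPn c0|/(_ j ij)]; last first.
    by move: ej ei; do ![move: (count _ _) => ?]; lia.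
  (* [i] still has to occur after [z = take m w]; the condition at its first
     occurrence bounds the number of [j]s in [z] by one. *)
  have iw : i \in w by rewrite -has_pred1 has_count cw.
  set p := index i w.
  have ltp : p < size w by rewrite index_mem.
  have take_p : take p.+1 w = rcons (take p w) i.
    by rewrite (take_nth i) // nth_index.
  have np : count_mem i (take p w) = 0.
    apply/count_memPn; apply/negP => /(nthP i)[q].
    rewrite size_takel ?(ltnW ltp) // => qp.
    by rewrite nth_take // => e; have := before_find i qp; rewrite /= e eqxx.
  have le_mp : m <= p.
    rewrite leqNgt; apply/negP => pm.
    have : i \in take m w.
      rewrite -(nth_index i iw) -/p -(nth_take i pm) mem_nth // size_take.
      by case: ifP.
    by move/count_memPn: c0 => /negP.
  have ep : count_mem i (take p.+1 w) = 1.
    by rewrite take_p -cats1 count_cat np /= eqxx.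
  case: (pw _ (prefix_take w p.+1) i) => [/count_memPn|/(_ j ij)].
    by rewrite ep.
  rewrite ep => cj1.
  have : count_mem j (take m w) <= count_mem j (take p.+1 w).
    rewrite -(@take_takel _ m p.+1 w) ?leqW //.
    by rewrite -{2}(cat_take_drop m (take p.+1 w)) count_cat leq_addr.
  by move: c0 cj1 ej ei; do ![move: (count _ _) => ?]; lia.
apply/word_condP; split=> // z /prefixP[s ews] i.
have [iz|iz] := boolP (i \in z); [right => j ij | by left].
have [_ /(_ i j ij)] := sw (size z).
have := cntE (size z) i; have := cntE (size z) j; rewrite !cw.
have -> : take (size z) w = z by rewrite ews take_size_cat.
have : 0 < count_mem i z by rewrite -has_count has_pred1.
by do ![move: (count _ _) => ?]; lia.
Qed.

Lemma count_drop_inj (T : eqType) (w w' : seq T) : size w = size w' ->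
  (forall m x, count_mem x (drop m w) = count_mem x (drop m w')) -> w = w'.
Proof.
elim: w w' => [|a w IHw] [|b w'] //= [esz] h.
have e : w = w' by apply: IHw => // m x; apply: (h m.+1).
have := h 0 a; rewrite e /= eqxx; case: (b =P a) => [->//|_]; lia.
Qed.

Lemma leq_count_drop (T : Type) (a : pred T) (w : seq T) m m' :
  m <= m' -> count a (drop m' w) <= count a (drop m w).
Proof.
move=> le_m; rewrite -(subnK le_m) -drop_drop.
by rewrite -{2}(cat_take_drop (m' - m) (drop m w)) count_cat leq_addl.
Qed.

Lemma sum_count_mem n (s : seq 'I_n) : \sum_i count_mem i s = size s.
Proof.
elim: s => [|a s IHs] /=; first by rewrite big1.
rewrite big_split /= IHs (bigD1 a) //= eqxx big1 // => i.
by rewrite eq_sym => /negPf->.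
Qed.

Lemma size_good_word k n (w : seq 'I_n) : word_cond k w -> size w = k.+1 * n.
Proof.
case/word_cond_state=> cw _; rewrite -sum_count_mem.
by rewrite (eq_bigr (fun=> k.+1)) // sum_nat_const card_ord mulnC.
Qed.

(** * Maximal chains when [h] identifies the poset with the states *)

Section ChainsOfStates.

Variables (k n : nat) (d : Order.disp_t) (P : finPOrderType d).
Variable h : P -> 'I_n -> nat.
Hypothesis h_le : forall x y, (x <= y)%O <-> forall i, h x i <= h y i.
Hypothesis h_state : forall x, is_state k (h x).
Hypothesis h_onto : forall b : 'I_n -> nat, is_state k b -> exists x, h x =1 b.

Definition word_chain (w : seq 'I_n) : {set P} :=
  [set x | [exists m : 'I_(size w).+1,
             [forall i, h x i == count_mem i (drop m w)]]].

Lemma word_chainP (w : seq 'I_n) x :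
  reflect (exists m, h x =1 (fun i => count_mem i (drop m w)))
          (x \in word_chain w).
Proof.
rewrite inE; apply: (iffP existsP) => [[m /forallP hm]|[m hm]].
  by exists m => i; apply/eqP.
have lt_m : minn m (size w) < (size w).+1 by rewrite ltnS geq_minr.
exists (Ordinal lt_m); apply/forallP => i /=; rewrite hm.
by case: leqP => // /ltnW le_wm; rewrite !drop_oversize.
Qed.

(** An element comparable to the whole chain is squeezed between two consecutive suffix counts,
    which differ by one at a single letter. *)
Lemma word_chain_max (w : seq 'I_n) :
  word_cond k w -> maxset (@is_chain d P) (word_chain w).
Proof.
case/word_cond_state => cw sw; apply/max_chainP; split.
  move=> x y /word_chainP[m hm] /word_chainP[m' hm'].
  have [le_m|/ltnW le_m] := leqP m m'; apply/orP; [right|left];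
    by apply/h_le => i; rewrite hm hm' leq_count_drop.
move=> y cy; apply/word_chainP.
(* The last suffix that dominates [h y] turns out to equal it. *)
pose below m := [forall i, h y i <= count_mem i (drop m w)].
have below0 : exists m, below m && (m <= size w).
  exists 0; rewrite andbT; apply/forallP => i; rewrite drop0 cw.
  by case: (h_state y).
have ub m : below m && (m <= size w) -> m <= size w by case/andP.
case: (ex_maxnP below0 ub) => m /andP[/forallP bm le_m] max_m.
exists m => i; apply/eqP; rewrite eqn_leq bm /=.
have [lt_m|ge_m] := ltnP m (size w); last by rewrite drop_oversize.
have nb : ~~ below m.+1.
  by apply/negP => b1; have := max_m m.+1; rewrite b1 lt_m ltnn => /(_ isT).
have [x hx] := h_onto (sw m.+1).
have xA : x \in word_chain w by apply/word_chainP; exists m.+1.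
have le_xy : forall j, count_mem j (drop m.+1 w) <= h y j.
  have /orP[/h_le le_yx|/h_le le_xy] := cy x xA; last by move=> j; rewrite -hx.
  by case/negP: nb; apply/forallP => j; rewrite -hx.
have eD j :
    count_mem j (drop m w) = (nth i w m == j) + count_mem j (drop m.+1 w).
  by rewrite (drop_nth i lt_m).
rewrite eD; have := le_xy i; case: (nth i w m =P i) => // ei _.
(* [h y] exceeds the next suffix somewhere, and this can only be at the letter just removed. *)
case/forallPn: nb => j; rewrite -ltnNge add1n => lt_j.
suff -> : i = j by [].
have := bm j; rewrite eD; case: (nth i w m =P j) => [<- _|_].
  by rewrite ei.
by rewrite leqNgt lt_j.
Qed.

(* The [m]-th element of the chain is recovered as the one of rank
   [size w - m]. *)
Lemma word_chain_inj (w w' : seq 'I_n) :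
  word_cond k w -> size w = size w' -> word_chain w = word_chain w' -> w = w'.
Proof.
case/word_cond_state=> _ sw esz eA; apply: count_drop_inj => // m i.
have [x hx] := h_onto (sw m).
have /word_chainP[m' hx'] : x \in word_chain w'.
  by rewrite -eA; apply/word_chainP; exists m.
have : size (drop m w) = size (drop m' w').
  by rewrite -!sum_count_mem; apply: eq_bigr => j _; rewrite -hx.
rewrite !size_drop -esz => e; rewrite -hx hx'.
have [lt_m|ge_m] := ltnP m (size w).
  by have -> : m' = m by lia.
by rewrite !drop_oversize -?esz //; lia.
Qed.

(** Induction on the rank [\sum_i h x i]. If [y] is an element of [A] of largest rank below [x], a
    unit step gives [z] with [y <= z < x]. Maximality puts [z] in [A], and the letter of the step is
    prepended to the word obtained from [z]. *)
Lemma max_chain_suffix (A : {set P}) : maxset (@is_chain d P) A ->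
  forall x, x \in A -> exists s : seq 'I_n,
    h x =1 (fun i => count_mem i s) /\
    forall m, exists2 y, y \in A & h y =1 (fun i => count_mem i (drop m s)).
Proof.
move=> /max_chainP[cA maxA] x.
have [r le_r] := ubnP (\sum_i h x i); elim: r => // r IHr in x le_r *.
move=> xA.
have [/forallP hx0|/forallPn[i0 hi0]] := boolP [forall i, h x i == 0].
  by exists [::]; split=> [i|m]; [apply/eqP | exists x => // i; apply/eqP].
(* The zero state is the minimum, hence in [A]: some element of [A] lies below [x]. *)
have [z0 hz0] : exists z, h z =1 (fun=> 0) by apply: h_onto; split.
have z0A : z0 \in A.
  by apply: maxA => y _; apply/orP; left; apply/h_le => i; rewrite hz0.
have lt_z0 : (z0 \in A) && (z0 < x)%O.
  rewrite z0A lt_neqAle /=; apply/andP; split.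
    by apply: contra hi0 => /eqP <-; rewrite hz0.
  by apply/h_le => i; rewrite hz0.
case: (@arg_maxnP _ z0 (fun y => (y \in A) && (y < x)%O)
                  (fun y => \sum_i h y i) lt_z0) => y /andP[yA lt_yx] max_y.
have /h_le le_yx := ltW lt_yx.
have [i lt_i st_i] :
    exists2 i, h y i < h x i & is_state k (fun j => h x j - (j == i)).
  apply: is_state_unit_step => //.
  apply/existsP; apply: contraT => /existsPn no.
  have : (x <= y)%O by apply/h_le => j; rewrite leqNgt.
  by move/(lt_le_trans lt_yx); rewrite ltxx.
have [z hz] := h_onto st_i.
have le_yz : (y <= z)%O.
  apply/h_le => j; rewrite hz; have := le_yx j.
  by case: (j =P i) => [-> _|_ /=]; [lia | rewrite subn0].
have le_zx : (z <= x)%O by apply/h_le => j; rewrite hz leq_subr.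
have zA : z \in A.
  apply: maxA => a aA; have /orP[le_xa|le_ax] := cA x a xA aA.
    by apply/orP; left; apply: le_trans le_xa.
  have [->|ne_ax] := eqVneq a x; first by apply/orP; left.
  have lt_ax : (a < x)%O by rewrite lt_neqAle ne_ax.
  have := cA a y aA yA; case/orP => [le_ay|/h_le le_ya].
    by apply/orP; right; apply: le_trans le_yz.
  (* Here [h y <= h a] pointwise while the rank of [a] is at most that of [y], so the two agree. *)
  have /max_y le_sum : (a \in A) && (a < x)%O by rewrite aA.
  suff le_ay : (a <= y)%O by apply/orP; right; apply: le_trans le_yz.
  apply/h_le => j; move: le_sum.
  rewrite (bigD1 j) //= (bigD1 j (P := predT)) //=.
  have : \sum_(l | l != j) h y l <= \sum_(l | l != j) h a l by apply: leq_sum.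
  by do 2![move: (\sum_(_ <- _ | _) _) => ?]; lia.
have hxE j : h x j = (i == j) + h z j.
  by rewrite hz [i == j]eq_sym; case: (j =P i) => [->|_] /=; lia.
have [] := IHr z _ zA.
  move: le_r; rewrite (eq_bigr _ (fun j _ => hxE j)) big_split /=.
  by rewrite (bigD1 i) //= eqxx; lia.
move=> s [hs sA]; exists (i :: s); split=> [j|[|m]]; first by rewrite hxE hs.
  by exists x => // j; rewrite hxE hs.
exact: sA.
Qed.

(** The descent from the top state, constant [k.+1], spells a word whose chain lies in [A]; that
    chain being maximal, the inclusion is an equality. *)
Lemma max_chain_word (A : {set P}) : maxset (@is_chain d P) A ->
  exists2 w : seq 'I_n, word_cond k w & word_chain w = A.
Proof.
move=> mA; have [cA maxA] := max_chainP _ mA.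
have [t ht] : exists t, h t =1 (fun=> k.+1) by apply: h_onto; split.
have tA : t \in A.
  apply: maxA => y _; apply/orP; right; apply/h_le => i.
  by rewrite ht; case: (h_state y).
have [w [hw wA]] := max_chain_suffix mA tA.
have gw : word_cond k w.
  apply/word_cond_state; split=> [i|m]; first by rewrite -hw ht.
  by have [y _ hy] := wA m; apply: eq_is_state hy _.
exists w => //.
have [_ max_w] := maxsetP (word_chain_max gw).
apply/esym/max_w; first by case/maxsetP: mA.
apply/subsetP => x /word_chainP[m hx]; have [y yA hy] := wA m.
suff -> : x = y by [].
by apply/le_anti/andP; split; apply/h_le => i; rewrite hx hy.
Qed.

Lemma max_chain_good_word_bij :
  exists f : max_chain P -> good_word k n, bijective f.
Proof.
have ex_w (A : max_chain P) :
    exists w : (k.+1 * n).-tuple 'I_n, word_cond k w && (word_chain w == val A).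
  have [w gw ew] := max_chain_word (valP A).
  have sw : size w == k.+1 * n by apply/eqP/size_good_word.
  by exists (Tuple sw); rewrite gw /= ew.
have gP A : word_cond k (xchoose (ex_w A)) by case/andP: (xchooseP (ex_w A)).
have fP (w : good_word k n) : maxset (@is_chain d P) (word_chain (val w)).
  exact: word_chain_max (valP w).
exists (fun A => exist _ (xchoose (ex_w A)) (gP A)).
exists (fun w : good_word k n => exist _ (word_chain (val w)) (fP w)) => [A|w];
  apply/val_inj.
  by rewrite /=; case/andP: (xchooseP (ex_w A)) => _ /eqP.
rewrite /=; set A := exist _ _ _.
case/andP: (xchooseP (ex_w A)) => gw /eqP eA.
by apply/val_inj/word_chain_inj; rewrite ?size_tuple.
Qed.

End ChainsOfStates.

(** * Iterated stackings as posets of states *)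

Notation stacked k := (stack_iter k (cube_seq 1)).

(* [t] counts the coordinates of the underlying vector from the right. *)
Fixpoint height k : forall n, stacked k n -> nat -> nat :=
  match k with
  | 0 => fun n (x : n.-tuple 'I_2) t => nth ord0 (rev x) t
  | k'.+1 => fun n (u : stack_type (stacked k') n) t =>
      (t < tag u) + height (tagged u) t
  end.

Lemma height_out k n (x : stacked k n) t : n <= t -> height x t = 0.
Proof.
elim: k n x => [|k IHk] n x le_nt /=.
  by rewrite nth_default // size_rev size_tuple.
case: x => j u /=; have := ltn_ord j => lt_j.
by rewrite IHk ?ltnNge; lia.
Qed.

(** Reversal turns the prepended zero into an appended one, which agrees with the default value of
    [nth]. *)
Lemma height_map k n (x : stacked k n) t : height (pseq_map _ x) t = height x t.
Proof.
case: k x => [|k] x /=; last by case: x.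
rewrite rev_cons nth_rcons; case: ltnP => // le_t.
by rewrite if_same [in RHS]nth_default.
Qed.

Lemma height_comp k m n (le_mn : m <= n) (x : stacked k m) t :
  height (pseq_comp le_mn x) t = height x t.
Proof.
rewrite /pseq_comp; move: (subnK le_mn); move: (n - m) => p.
case: n / {le_mn} => /=.
by elim: p => //= p IHp; rewrite height_map.
Qed.

(** Heights determine the order of the indices: if [l < j], then at [t = l] the left height is
    positive and the right one is zero. Once [j <= l], the indicators cancel below [j], and [u] has
    height zero from [j] on. *)
Lemma height_le k n (x y : stacked k n) :
  (x <= y)%O <-> forall t, height x t <= height y t.
Proof.
elim: k n x y => [|k IHk] n x y.
  rewrite leEtprod /=; split=> [/forallP le_xy t|le_xy].
    have [lt_t|le_t] := ltnP t n; last first.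
      by rewrite nth_default // size_rev size_tuple.
    rewrite !nth_rev ?size_tuple // -(tnth_nth ord0 x (rev_ord (Ordinal lt_t))).
    by rewrite -(tnth_nth ord0 y (rev_ord (Ordinal lt_t))); apply: le_xy.
  apply/forallP => i; have := le_xy (rev_ord i).
  rewrite !nth_rev ?size_tuple ?ltn_ord //=.
  by rewrite -subSn ?ltn_ord // subSS subKn ?(ltnW (ltn_ord _)) // -!tnth_nth.
case: x y => [j u] [l v]; rewrite [(_ <= _)%O]/(stack_le _ _).
split=> [/stack_leP[/= le_jl /IHk le_uv] t|le_uv].
  by have := le_uv t; rewrite height_comp; lia.
have le_jl : j <= l.
  rewrite leqNgt; apply/negP => lt_lj; have := le_uv l => /=.
  by rewrite lt_lj ltnn (height_out v).
apply/stack_leP; exists le_jl; apply/IHk => t /=; rewrite height_comp.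
have [lt_tj|le_jt] := ltnP t j; last by rewrite (height_out u).
by have := le_uv t => /=; rewrite lt_tj (leq_trans lt_tj le_jl) ltnS.
Qed.

(** Below the index [j] the truncated height goes from [minn _ k] to [(minn _ k).+1]; from [j] on it
    is zero. *)
Lemma height_state k n (x : stacked k n) :
  (forall t, height x t <= k.+1) /\
  {homo (fun t => minn (height x t) k) : s t /~ s <= t}.
Proof.
elim: k n x => [|k IHk] n x.
  by split=> [t|s t _]; rewrite ?minn0 //= -ltnS ltn_ord.
case: x => j u /=; have [uk mu] := IHk _ u.
split=> [t|s t le_st]; first by have := uk t; lia.
have := mu s t le_st; have [lt_sj|le_js] := ltnP s j; last first.
  by rewrite (height_out u le_js) min0n.
rewrite (leq_ltn_trans le_st lt_sj); lia.
Qed.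

Lemma height_onto k n (b : nat -> nat) :
  (forall t, b t <= k.+1) -> {homo (fun t => minn (b t) k) : s t /~ s <= t} ->
  (forall t, n <= t -> b t = 0) -> exists x : stacked k n, height x =1 b.
Proof.
elim: k n b => [|k IHk] n b bk mb b0.
  pose x : n.-tuple 'I_2 := [tuple inord (b (rev_ord i)) | i < n].
  exists x => t; rewrite -[LHS]/(nat_of_ord (nth ord0 (rev x) t)).
  have [lt_t|le_t] := ltnP t n; last first.
    by rewrite b0 // nth_default // size_rev size_tuple.
  rewrite nth_rev ?size_tuple // -[n - _]/(val (rev_ord (Ordinal lt_t))).
  by rewrite -tnth_nth tnth_mktuple rev_ordK inordK // ltnS.
have ex0 : exists t, b t == 0 by exists n; rewrite b0.
(* The outermost index is the first zero of [b]; subtracting its indicator leaves the predecessor of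
   [b]. *)
case: (ex_minnP ex0) => j /eqP bj min_j.
have le_jn : j <= n by apply: min_j; rewrite b0.
have b_gt0 t : (0 < b t) = (t < j).
  have [lt_tj|le_jt] := ltnP t j.
    by rewrite lt0n; apply: contraL lt_tj => /min_j; rewrite -leqNgt.
  (* The truncation level is [k.+1 > 0], so a zero at [j] forces zeros afterwards. *)
  by have := mb _ _ le_jt; rewrite bj; lia.
have [||| u hu] := IHk j (fun t => (b t).-1).
- by move=> t; have := bk t; lia.
- by move=> s t le_st /=; have := mb s t le_st; lia.
- by move=> t; rewrite leqNgt -b_gt0; lia.
exists (existT (fun j : 'I_n.+1 => stacked k j) (Ordinal (le_jn : j < n.+1)) u).
by move=> t /=; rewrite hu -b_gt0; lia.
Qed.

Theorem theorem2p2 (k n : nat) :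
  exists f : max_chain (stack_iter k (cube_seq 1) n) -> good_word k n,
    bijective f.
Proof.
(* [rev_ord] converts positions from the right into letters, and nonincreasing into
   nondecreasing. *)
apply: (@max_chain_good_word_bij k n _ _ (fun x i => height x (rev_ord i))).
- move=> x y; rewrite height_le; split=> [le_xy i //|le_xy t].
  have [lt_t|le_t] := ltnP t n; last by rewrite !height_out.
  by have := le_xy (rev_ord (Ordinal lt_t)); rewrite rev_ordK.
- move=> x; have [xk mx] := height_state x; split=> // i j lt_ij.
  by apply: mx => /=; lia.
move=> b [bk mb].
(* Extension by zero past [n], as heights vanish there. *)
pose b' t := if insub t is Some i then b (rev_ord i) else 0.
have b'E t (lt_t : t < n) : b' t = b (rev_ord (Ordinal lt_t)).
  by rewrite /b' insubT.
have b'0 t : n <= t -> b' t = 0.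
  by move=> le_t; rewrite /b' insubF // ltnNge le_t.
have [t|s t le_st|x hx] := @height_onto k n b' _ _ b'0.
- by rewrite /b'; case: insub.
- have [lt_s|le_s] := ltnP s n; last by rewrite (b'0 s) // min0n.
  have lt_t := leq_ltn_trans le_st lt_s; rewrite !b'E.
  have [->//|ne_st] := eqVneq (Ordinal lt_s) (Ordinal lt_t).
  by apply: mb; move: ne_st; rewrite -val_eqE /=; lia.
exists x => i; rewrite hx b'E; congr b.
by apply/val_inj => /=; have := ltn_ord i; lia.
Qed.
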